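(* Let $\mu$ be a Borel probability measure on $\mathbb{R}$. Suppose that there exists $C>0$ such that $|\widehat{\mu}(\xi)|\le C|\xi|^{-1}$ for all $\xi\in\mathbb{R}\setminus\{0\}$. Let $A>0$ and let $\Lambda=\{\lambda_k\}_{k\in\mathbb{Z}}\subset\mathbb{R}$ be a countable set, enumerated in strictly increasing order, such that $$\sum_{\lambda\in\Lambda}\Big|\int f(x)e^{-2\pi i\lambda x}\,d\mu(x)\Big|^2\ge A\int|f(x)|^2\,d\mu(x)\qquad\text{for all } f\in L^2(\mu).$$ Then $$g_{\min}(\Lambda)^2\le\frac{C^2\pi^2}{A},$$ and, if moreover $A>\frac32$, then $$g_{\min}(\Lambda)^2\le\frac{C^2\pi^2}{3(A-1)}.$$
   Context: The Fourier transform of $\mu$ is $\widehat{\mu}(\xi)=\int e^{-2\pi i\xi x}\,d\mu(x)$. For a set $\Lambda=\{\lambda_k\}_{k\in\mathbb{Z}}\subset\mathbb{R}$ with $\lambda_n<\lambda_m$ whenever $n<m$, the spectral gaps are $g_k(\Lambda):=\lambda_k-\lambda_{k-1}$, $k\in\mathbb{Z}$. The essential minimal spectral gap is $$g_{\min}(\Lambda):=\inf\{c\ge 0: g_k(\Lambda)<c\text{ for infinitely many }k\}.$$ *)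

(* Defs.v *)
From HB Require Import structures.
From mathcomp Require Import all_boot all_order all_algebra.
From mathcomp Require Import all_classical all_reals all_analysis.
From mathcomp Require Export complex.

Set Implicit Arguments.
Unset Strict Implicit.
Unset Printing Implicit Defensive.

Import Order.TTheory GRing.Theory Num.Theory.
Import numFieldNormedType.Exports.

Local Open Scope classical_set_scope.
Local Open Scope ring_scope.
Local Open Scope complex_scope.

Notation cmod := ComplexField.Normc.normc.

Definition fourier_char {R : realType} (xi x : R) : R[i] :=
  let t := - (2 * pi * xi * x) in cos t +i* sin t.

(* [Rintegral] is 0 by convention when the integral diverges to an infinity or
   is undefined; below it is only applied to [mu]-integrable functions. *)
Definition Cintegral {R : realType} (mu : probability (measurableTypeR R) R)
    (f : R -> R[i]) : R[i] :=
  (\int[mu]_x complex.Re (f x)) +i* (\int[mu]_x complex.Im (f x)).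

Definition fourier {R : realType} (mu : probability (measurableTypeR R) R)
    (xi : R) : R[i] :=
  Cintegral mu (fourier_char xi).

Definition L2_sqnorm {R : realType} (mu : probability (measurableTypeR R) R)
    (f : R -> R[i]) : \bar R :=
  (\int[mu]_x ((cmod (f x)) ^+ 2)%:E)%E.

Definition is_L2 {R : realType} (mu : probability (measurableTypeR R) R)
    (f : R -> R[i]) : Prop :=
  [/\ measurable_fun [set: measurableTypeR R] (fun x : R => complex.Re (f x)),
      measurable_fun [set: measurableTypeR R] (fun x : R => complex.Im (f x)) &
      (L2_sqnorm mu f < +oo)%E].

Definition gap {R : realType} (lam : int -> R) (k : int) : R :=
  lam k - lam (k - 1).

(* Valued in [\bar R]: the set of admissible [c] is empty when
   [gap lam k --> +oo] as [`|k| --> +oo], and the infimum is then [+oo]. *)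
Definition gmin {R : realType} (lam : int -> R) : \bar R :=
  ereal_inf [set c%:E | c in
    [set c : R | 0 <= c /\ infinite_set [set k : int | gap lam k < c]]].

(* Main.v *)
(** Testing the frame inequality on the character of frequency -xi, of norm 1,
    gives A <= sum_k |mu^(lam_k - xi)|^2 for every real xi.  Fix g' < g < gmin.
    Only finitely many gaps are shorter than g, so seen from lam_n with n large
    the j-th neighbour on either side is at distance at least j g'.
    With xi the midpoint of lam_(n-1) and lam_n, the decay of mu^ bounds the
    right-hand side by 2 C^2 / g'^2 sum_j (j + 1/2)^-2 = C^2 pi^2 / g'^2; with
    xi = lam_n, where one term equals 1, by
    1 + 2 C^2 / g'^2 sum_j (j + 1)^-2 = 1 + C^2 pi^2 / (3 g'^2). *)

Require Import Defs.
From mathcomp Require Import all_boot all_order all_algebra.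
From mathcomp Require Import all_classical all_reals all_analysis.
From mathcomp Require Import measurable_realfun ring lra zify.

Import Order.TTheory GRing.Theory Num.Theory.
Import numFieldNormedType.Exports.
Local Open Scope classical_set_scope.
Local Open Scope ring_scope.

(** * Bounds for sums of inverse squares, obtained from the sine *)

Lemma sin_le_id (R : realType) (x : R) : 0 <= x -> sin x <= x.
Proof.
move=> x0.
have dsin y : y \in `]0, x[%R -> is_derive y 1 sin (cos y).
  by move=> _; exact: is_derive_sin.
have csin : {within `[0, x], continuous (@sin R)}.
  by apply: continuous_subspaceT => y; exact: continuous_sin.
have [c _] := MVT_segment x0 dsin csin.
by rewrite sin0 !subr0 => ->; rewrite ler_piMl// cos_le1.
Qed.

Lemma invsqr_sinDcos (R : realType) (x : R) : sin x != 0 -> cos x != 0 ->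
  (sin x ^+ 2)^-1 + (cos x ^+ 2)^-1 = 4 * (sin (x *+ 2) ^+ 2)^-1.
Proof.
move=> s0 c0; rewrite sin_mulr2n.
transitivity ((cos x ^+ 2 + sin x ^+ 2) / (cos x * sin x) ^+ 2).
  by field; rewrite s0 c0.
by rewrite cos2Dsin2; field; rewrite s0 c0.
Qed.

(* Doubling: the angles [x] and [pi / 2 - x] of level [n.+1] merge into the angle [2 x] of level [n]. *)
Lemma sum_invsqr_sin (R : realType) (n : nat) :
  \sum_(k < 2 ^ n) (sin ((k%:R + 2^-1) * (pi / 2 ^+ n.+1)) ^+ 2)^-1
    = 2 * 4 ^+ n :> R.
Proof.
elim: n => [|n IHn].
  rewrite big_ord1 expr0 mulr1 add0r expr1.
  set x : R := 2^-1 * (pi / 2).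
  have sc : sin x = cos x.
    have {1}-> : x = pi / 2 - x by rewrite /x; field.
    by rewrite sinB sin_pihalf cos_pihalf mul1r mul0r subr0.
  have := cos2Dsin2 x; rewrite sc -mulr2n => h.
  have -> : cos x ^+ 2 = 2^-1 by lra.
  by rewrite invrK.
have [p q] : (0 < pi :> R) /\ (0 < 2 ^+ n :> R) by rewrite pi_gt0 exprn_gt0.
rewrite expnS mul2n -addnn big_split_ord /=.
(* Reversing the upper half of the indices pairs each angle [x] with [pi / 2 - x]. *)
rewrite [X in _ + X](reindex_inj rev_ord_inj) -big_split /=.
transitivity (4 * (2 * 4 ^+ n : R)); last by rewrite exprS; ring.
rewrite -IHn mulr_sumr; apply: eq_bigr => k _.
set x := (k%:R + 2^-1) * (pi / 2 ^+ n.+2).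
have -> : (k%:R + 2^-1) * (pi / 2 ^+ n.+1) = x *+ 2 :> R.
  by rewrite /x !exprS; field; rewrite gt_eqF.
have -> : ((2 ^ n + (2 ^ n - k.+1))%N%:R + 2^-1) * (pi / 2 ^+ n.+2) = pi / 2 - x :> R.
  rewrite natrD natrB ?ltn_ord// -natr1 natrX /x !exprS.
  by field; rewrite gt_eqF.
have x0 : 0 < x by rewrite /x mulr_gt0 ?divr_gt0 ?exprn_gt0// ltr_wpDl.
have xpi : x < pi / 2.
  rewrite /x mulrCA ltr_pM2l// ltr_pdivrMr ?exprn_gt0// !exprS.
  have : (k.+1%:R <= 2 ^+ n :> R) by rewrite -natrX ler_nat ltn_ord.
  by rewrite -natr1; lra.
rewrite sinB sin_pihalf cos_pihalf mul1r mul0r subr0.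
apply: invsqr_sinDcos; apply/lt0r_neq0.
  by apply: sin_gt0_pihalf; rewrite x0.
by apply: cos_gt0_pihalf; rewrite xpi andbT; lra.
Qed.

(** With [y = pi / 2 ^+ n.+1], [sin t <= t] compares the first [2 ^ n] terms, divided by [y ^+ 2],
    with the exact sine sum [2 * 4 ^+ n], which is [pi ^+ 2 / 2] divided by [y ^+ 2]. *)
Lemma sum_invsqr_half (R : realType) (J : nat) :
  \sum_(j < J) ((j%:R + 2^-1) ^+ 2)^-1 <= pi ^+ 2 / 2 :> R.
Proof.
have p : 0 < pi :> R by rewrite pi_gt0.
have h n : \sum_(j < 2 ^ n) ((j%:R + 2^-1) ^+ 2)^-1 <= pi ^+ 2 / 2 :> R.
  set y : R := pi / 2 ^+ n.+1.
  have y0 : 0 < y by rewrite divr_gt0// exprn_gt0.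
  have yV0 : 0 < (y ^+ 2)^-1 by rewrite invr_gt0 exprn_gt0.
  rewrite -(ler_pM2r yV0) mulr_suml.
  have -> : pi ^+ 2 / 2 / y ^+ 2 = 2 * 4 ^+ n :> R.
    rewrite /y exprMn exprVn -!exprM mulnC exprM (exprS _ n).
    have -> : 2 ^+ 2 = 4 :> R by ring.
    by move: (pi : R) p => q q0; field; rewrite !gt_eqF ?exprn_gt0.
  rewrite -sum_invsqr_sin; apply: ler_sum => k _.
  have k0 : 0 < k%:R + 2^-1 :> R by rewrite ltr_wpDl.
  have t0 : 0 < (k%:R + 2^-1) * y by rewrite mulr_gt0.
  have tpi : (k%:R + 2^-1) * y < pi / 2.
    rewrite /y mulrCA ltr_pM2l// ltr_pdivrMr ?exprn_gt0// !exprS.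
    have : (k.+1%:R <= 2 ^+ n :> R) by rewrite -natrX ler_nat ltn_ord.
    by rewrite -natr1; lra.
  have s0 : 0 < sin ((k%:R + 2^-1) * y).
    by apply: sin_gt0_pihalf; rewrite t0.
  rewrite -invfM -exprMn lef_pV2 ?posrE ?exprn_gt0//.
  rewrite ler_pXn2r ?nnegrE ?(ltW s0) ?(ltW t0)//; exact: sin_le_id (ltW t0).
(* Since [J < 2 ^ J] and the terms are nonnegative, the case of [2 ^ J] terms covers [J] terms. *)
apply: le_trans (h J); rewrite -!(big_mkord xpredT (fun j => ((j%:R + 2^-1) ^+ 2)^-1)).
rewrite [leRHS](@big_cat_nat _ _ _ J)//=; last exact/ltnW/ltn_expl.
by rewrite lerDl sumr_ge0// => i _; rewrite invr_ge0 sqr_ge0.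
Qed.

(** Among the first [2 J] terms the odd bases give a quarter of the half-integer sum and the even
    ones a quarter of [P J]. As [P J <= P J.*2], [P J] is at most a third of the half-integer
    sum. *)
Lemma sum_invsqr (R : realType) (J : nat) :
  \sum_(j < J) ((j%:R + 1) ^+ 2)^-1 <= pi ^+ 2 / 6 :> R.
Proof.
rewrite -(big_mkord xpredT (fun j => ((j%:R + 1) ^+ 2)^-1)).
set P := fun J => \sum_(0 <= j < J) ((j%:R + 1) ^+ 2)^-1 : R.
have split : P J.*2 = 4^-1 * (\sum_(j < J) ((j%:R + 2^-1) ^+ 2)^-1) + 4^-1 * P J.
  rewrite /P -(big_mkord xpredT (fun j => ((j%:R + 2^-1) ^+ 2)^-1)).
  elim: J {P} => [|J IH]; first by rewrite !big_nil mulr0 addr0.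
  rewrite doubleS !big_nat_recr//= IH !mulrDr -mul2n -natr1 natrM.
  have j0 : 0 <= J%:R :> R by [].
  by field; rewrite !gt_eqF//; lra.
have mono : P J <= P J.*2.
  rewrite /P [leRHS](@big_cat_nat _ _ _ J)//=; last by rewrite -addnn leq_addr.
  by rewrite lerDl sumr_ge0// => i _; rewrite invr_ge0 sqr_ge0.
have := sum_invsqr_half R J.
rewrite -/(P J); lra.
Qed.

(** * Nonnegative series and sums over the integers *)

Lemma nneseries_le (R : realType) (u : nat -> R) (M : R) :
  (forall j, 0 <= u j) -> (forall J, \sum_(j < J) u j <= M) ->
  (\sum_(j <oo) (u j)%:E <= M%:E)%E.
Proof.
move=> u0 uM; apply: lime_le.
  by apply: is_cvg_nneseries => i _ _; rewrite lee_fin.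
by apply: nearW => J; rewrite sumEFin lee_fin big_mkord.
Qed.

Lemma esum_int_split (R : realType) (f : int -> \bar R) (n : int) :
  (forall k, 0 <= f k)%E ->
  (\esum_(k in setT) f k =
   \sum_(j <oo) f (n + j%:Z)%R + \sum_(j <oo) f (n - 1 - j%:Z)%R)%E.
Proof.
move=> f0; rewrite (esumID [set k | n <= k])//; congr (_ + _)%E.
- rewrite nneseries_esumT//.
  apply: (@reindex_esum _ _ _ setT _ (fun j : nat => n + j%:Z)); split.
  + by move=> j _ /=; split=> //; lia.
  + by move=> i j _ _ /addrI [].
  + by move=> k [_ /= nk]; exists (absz (k - n)%R) => //; lia.
- rewrite nneseries_esumT//.
  apply: (@reindex_esum _ _ _ setT _ (fun j : nat => n - 1 - j%:Z)); split.
  + by move=> j _ /=; split=> //; lia.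
  + by move=> i j _ _ /addrI /oppr_inj [].
  + by move=> k [_ /= nk]; exists (absz (n - 1 - k)%R) => //; lia.
Qed.

(** * Characters as test functions *)

Lemma cmod_sqr (R : realType) (z : R[i]%C) :
  cmod z ^+ 2 = complex.Re z ^+ 2 + complex.Im z ^+ 2.
Proof. by case: z => a b /=; rewrite sqr_sqrtr// addr_ge0 ?sqr_ge0. Qed.

Lemma fourier_charD (R : realType) (a b x : R) :
  fourier_char a x * fourier_char b x = fourier_char (a + b) x.
Proof.
rewrite /fourier_char.
have -> : - (2 * pi * (a + b) * x) = - (2 * pi * a * x) + - (2 * pi * b * x).
  by ring.
by rewrite cosD sinD; apply/eqP; rewrite eq_complex /= eqxx /= addrC.
Qed.

Lemma cmod_fourier_char (R : realType) (xi x : R) :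
  cmod (fourier_char xi x) ^+ 2 = 1.
Proof. by rewrite cmod_sqr /= cos2Dsin2. Qed.

Lemma L2_sqnorm_fourier_char (R : realType)
    (mu : probability (measurableTypeR R) R) (xi : R) : L2_sqnorm mu (fourier_char xi) = 1%E.
Proof.
rewrite /L2_sqnorm; under eq_integral do rewrite cmod_fourier_char.
by rewrite integral_cst// mul1e; exact: (probability_setT mu).
Qed.

Lemma is_L2_fourier_char (R : realType)
    (mu : probability (measurableTypeR R) R) (xi : R) : is_L2 mu (fourier_char xi).
Proof.
have mlin : measurable_fun [set: measurableTypeR R]
    (fun x : R => - (2 * pi * xi * x)).
  by apply: continuous_measurable_fun => x; apply: cvgN; apply: cvgMr; exact: cvg_id.
split; last by rewrite L2_sqnorm_fourier_char ltry.
- apply: measurableT_comp mlin.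
  by apply: continuous_measurable_fun; exact: continuous_cos.
- apply: measurableT_comp mlin.
  by apply: continuous_measurable_fun; exact: continuous_sin.
Qed.

Lemma cmod_fourier0 (R : realType)
    (mu : probability (measurableTypeR R) R) : cmod (fourier mu 0) = 1.
Proof.
rewrite /fourier /Cintegral.
under eq_Rintegral do rewrite /fourier_char mulr0 mul0r oppr0 cos0 /=.
under [X in complex.Complex _ X]eq_Rintegral do
  rewrite /fourier_char mulr0 mul0r oppr0 sin0 /=.
rewrite !Rintegral_cst// mul0r mul1r.
have -> : fine (mu setT) = 1 by rewrite (_ : mu setT = 1%E)//; exact: (probability_setT mu).
by rewrite /= expr1n expr0n addr0 sqrtr1.
Qed.

(** Multiplying by [fourier_char l] adds frequencies, so the test function of frequency [- xi] has
    coefficient [fourier mu (l - xi)] at [l]. The sum is cut at [n] to treat each side of [xi]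
    separately. *)
Lemma frame_fourier_char (R : realType)
    (mu : probability (measurableTypeR R) R) (A : R) (lam : int -> R)
    (lam_inj : injective lam)
    (hframe : forall f : R -> complex R, is_L2 mu f ->
      (A%:E * L2_sqnorm mu f <=
       \esum_(l in range lam)
         (cmod (Cintegral mu (fun x : R => (f x * fourier_char l x)%R)) ^+ 2)%:E)%E)
    (xi : R) (n : int) :
  (A%:E <= \sum_(j <oo) (cmod (fourier mu (lam (n + j%:Z)%R - xi)) ^+ 2)%:E
         + \sum_(j <oo) (cmod (fourier mu (lam (n - 1 - j%:Z)%R - xi)) ^+ 2)%:E)%E.
Proof.
rewrite -(@esum_int_split _ (fun k => (cmod (fourier mu (lam k - xi)) ^+ 2)%:E));
  last by move=> k; rewrite lee_fin sqr_ge0.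
have := hframe _ (is_L2_fourier_char _ mu (- xi)).
rewrite L2_sqnorm_fourier_char mule1 => /le_trans; apply.
rewrite (@reindex_esum _ _ _ setT _ lam); last first.
  by split=> [k _|i j _ _|//]; [exists k|exact: lam_inj].
apply: le_esum => k _; rewrite (_ : Cintegral _ _ = fourier mu (lam k - xi))//.
rewrite /fourier; congr Cintegral; apply/funext => x.
by rewrite fourier_charD addrC.
Qed.

(** * Separation of [lam] far to the right *)

Lemma finite_set_int_bounded (A : set int) : finite_set A ->
  exists N : nat, forall k, A k -> (absz k < N)%N.
Proof.
move=> /finite_seqP[s ->]; exists (\max_(k <- s) absz k).+1 => k /= ks.
by rewrite ltnS; exact: (leq_bigmax_seq k).
Qed.

(* The finitely many short gaps cost a bounded amount, absorbed by [g - g'] when counting from far to the right. *)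
Lemma eventually_separated (R : realType) (lam : int -> R) (g g' : R) :
  (forall m n : int, m < n -> lam m < lam n) -> 0 < g' < g ->
  finite_set [set k | gap lam k < g] ->
  exists n0 : int, forall n : int, n0 <= n -> forall j : nat,
    g' * j%:R <= lam (n + j%:Z) - lam n /\
    g' * j%:R <= lam n - lam (n - j%:Z).
Proof.
move=> lam_mono /andP[g'0 g'g] /finite_set_int_bounded[N smallN].
have lam_le m n : m <= n -> lam m <= lam n.
  by rewrite le_eqVlt => /predU1P[->//|/lam_mono/ltW].
have gapN (k : int) : (N <= absz k)%N -> g <= lam k - lam (k - 1).
  by rewrite leNgt; apply: contraTN => /smallN; rewrite -ltnNge.
have right (n : int) (j : nat) : N%:Z <= n -> g * j%:R <= lam (n + j%:Z) - lam n.
  move=> Nn; elim: j => [|j IH]; first by rewrite mulr0 addr0 subrr.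
  have := gapN (n + j.+1%:Z) ltac:(lia).
  have -> : n + j.+1%:Z - 1 = n + j%:Z by lia.
  by rewrite -natr1; lra.
have left (n : int) (j : nat) : n <= - N%:Z -> g * j%:R <= lam n - lam (n - j%:Z).
  move=> Nn; elim: j => [|j IH]; first by rewrite mulr0 subr0 subrr.
  have := gapN (n - j%:Z) ltac:(lia).
  have -> : n - j%:Z - 1 = n - j.+1%:Z by lia.
  by rewrite -natr1; lra.
(* The [2 N] steps between [- N] and [N] may be short and cost at most [2 * g * N]; saving [g - g']
   on each of [M] steps pays for them. *)
have [M hM] : exists M : nat, 2 * g * N%:R <= (g - g') * M%:R.
  exists (Num.truncn (2 * g * N%:R / (g - g'))).+1.
  have d0 : 0 < g - g' by rewrite subr_gt0.
  by rewrite [leRHS]mulrC -ler_pdivrMr// ltW//; exact: truncnS_gt.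
exists (N%:Z + M%:Z) => n n0n j.
have g'j : g' * j%:R <= g * j%:R by rewrite ler_wpM2r// ltW.
split; first by apply: le_trans g'j (right _ _ _); lia.
(* To the left, [n - j] lies right of [N], between [- N] and [N], or beyond [- N]. Between [- N] and
   [N] only monotonicity of [lam] is used. *)
have [Nnj|nj] := leP N%:Z (n - j%:Z).
  by apply: le_trans g'j _; rewrite -{1}(subrK j%:Z n); exact: right.
have hj : (g - g') * M%:R <= (g - g') * j%:R.
  by rewrite ler_wpM2l ?subr_ge0 ?(ltW g'g)// ler_nat; lia.
have far : g * (absz (n - N%:Z)%R)%:R <= lam n - lam N%:Z.
  have {2}-> : n = N%:Z + (absz (n - N%:Z)%R)%:Z by lia.
  exact: right.
suff : g * (j%:R - 2 * N%:R) <= lam n - lam (n - j%:Z).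
  by lra.
have [Nnj|Nnj] := leP (- N%:Z) (n - j%:Z).
  have h1 : lam (n - j%:Z) <= lam N by apply: lam_le; lia.
  have h2 : j%:R <= (absz (n - N%:Z)%R)%:R + 2 * N%:R :> R.
    by rewrite -natrM -natrD ler_nat; lia.
  have : g * (j%:R - 2 * N%:R) <= g * (absz (n - N%:Z)%R)%:R.
    by rewrite ler_wpM2l//; lra.
  lra.
have h1 : g * (absz (- N%:Z - (n - j%:Z))%R)%:R <= lam (- N%:Z) - lam (n - j%:Z).
  have {2}-> : n - j%:Z = - N%:Z - (absz (- N%:Z - (n - j%:Z))%R)%:Z by lia.
  exact: left.
have h2 : lam (- N%:Z) <= lam N by apply: lam_le; lia.
have h3 : j%:R = (absz (n - N%:Z)%R)%:R + (absz (- N%:Z - (n - j%:Z))%R)%:R + 2 * N%:R :> R.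
  by rewrite -natrM -!natrD; congr _%:R; lia.
move: h1 far; rewrite h3; lra.
Qed.

(** * Decay estimate and reduction to finitely many short gaps *)

Lemma lt_gmin_finite (R : realType) (lam : int -> R) (g : R) :
  0 <= g -> (g%:E < gmin lam)%E -> finite_set [set k | gap lam k < g].
Proof.
move=> g0; apply: contraPP => fg; apply/negP; rewrite -leNgt.
by apply: ereal_inf_lbound; exists g.
Qed.

(** Serves every one-sided sum: [c] is [1/2] around a midpoint and [1] around a point of [lam]. The
    separation keeps [t j] away from 0, where the decay says nothing. *)
Lemma sum_fourier_sqr_le (R : realType) (mu : probability (measurableTypeR R) R)
    (C : R) (hC : 0 < C)
    (hmu : forall xi : R, xi != 0 -> cmod (fourier mu xi) <= C * `|xi|^-1)
    (t : nat -> R) (g c Q : R) (J : nat) :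
  0 < g -> 0 < c -> (forall j, g * (j%:R + c) <= `|t j|) ->
  \sum_(j < J) ((j%:R + c) ^+ 2)^-1 <= Q ->
  \sum_(j < J) cmod (fourier mu (t j)) ^+ 2 <= C ^+ 2 / g ^+ 2 * Q.
Proof.
move=> g0 c0 ht hQ.
have K0 : 0 < C ^+ 2 / g ^+ 2 by rewrite divr_gt0 ?exprn_gt0.
apply: le_trans (_ : C ^+ 2 / g ^+ 2 * \sum_(j < J) ((j%:R + c) ^+ 2)^-1 <= _);
  last by rewrite ler_pM2l.
rewrite mulr_sumr; apply: ler_sum => j _.
have jc : 0 < g * (j%:R + c) by rewrite mulr_gt0// ltr_wpDl.
have tj : 0 < `|t j| by exact: lt_le_trans jc (ht j).
have -> : C ^+ 2 / g ^+ 2 * ((j%:R + c) ^+ 2)^-1 = (C * (g * (j%:R + c))^-1) ^+ 2.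
  by rewrite exprMn exprVn exprMn (invfM (g ^+ 2)) (mulrA (C ^+ 2)).
rewrite ler_pXn2r ?nnegrE//.
- by apply: le_trans (hmu _ _) _; rewrite -?normr_gt0// ler_pM2l// lef_pV2.
- by case: (fourier mu (t j)) => a b /=; exact: sqrtr_ge0.
- by rewrite mulr_ge0 ?invr_ge0// ltW.
Qed.

(** If [gmin] exceeded [Num.sqrt B], both [g'] and [g] would fit strictly in between, and
    [g' ^+ 2 <= B] would fail. Two numbers are needed because separation loses a little, from [g] to
    [g']. *)
Lemma gmin_sqr_le (R : realType) (lam : int -> R) (B : R) : 0 <= B ->
  (forall g' g : R, 0 < g' < g -> finite_set [set k | gap lam k < g] ->
    g' ^+ 2 <= B) ->
  (gmin lam ^+ 2 <= B%:E)%E.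
Proof.
move=> B0 hB.
have gmin0 : (0 <= gmin lam)%E.
  by apply: le_ereal_inf_tmp => _ [c [c0 _] <-]; rewrite lee_fin.
have hs : (gmin lam <= (Num.sqrt B)%:E)%E.
  rewrite leNgt; apply/negP => sB.
  have [g' [g [sg g'g ggm]]] : exists g' g : R,
      [/\ Num.sqrt B < g', g' < g & (g%:E < gmin lam)%E].
    case: (gmin lam) sB => [r| |]//; last first.
      by exists (Num.sqrt B + 1), (Num.sqrt B + 2); rewrite ltry; split => //; lra.
    rewrite lte_fin => sB.
    exists ((2 * Num.sqrt B + r) / 3), ((Num.sqrt B + 2 * r) / 3).
    by rewrite lte_fin; split; lra.
  have s0 := sqrtr_ge0 B.
  have := hB g' g; rewrite g'g (le_lt_trans s0 sg) => /(_ isT).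
  have g0 : 0 <= g by lra.
  move=> /(_ (lt_gmin_finite _ _ _ g0 ggm)).
  by rewrite leNgt -[in X in X < _](sqr_sqrtr B0) ltr_pXn2r ?nnegrE ?sg//; lra.
rewrite -[in leRHS](sqr_sqrtr B0) EFin_expe.
by rewrite !expe2 lee_pmul.
Qed.

Theorem mainTheorem2 (R : realType) (mu : probability (measurableTypeR R) R)
    (C : R) (hC : 0 < C)
    (hmu : forall xi : R, xi != 0 -> cmod (fourier mu xi) <= C * `|xi|^-1)
    (A : R) (hA : 0 < A)
    (lam : int -> R) (hlam : forall m n : int, m < n -> lam m < lam n)
    (hframe : forall f : R -> complex R, is_L2 mu f ->
      (A%:E * L2_sqnorm mu f <=
       \esum_(l in range lam)
         (cmod (Cintegral mu (fun x : R => (f x * fourier_char l x)%R)) ^+ 2)%:E)%E) :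
  (gmin lam ^+ 2 <= (C ^+ 2 * pi ^+ 2 / A)%:E)%E /\
  (3 / 2 < A -> (gmin lam ^+ 2 <= (C ^+ 2 * pi ^+ 2 / (3 * (A - 1)))%:E)%E).
Proof.
have lam_inj : injective lam.
  by move=> m n mn; case: (ltgtP m n) => // /hlam; rewrite mn ltxx.
have series_le (t : nat -> R) M :
    (forall J, \sum_(j < J) cmod (fourier mu (t j)) ^+ 2 <= M) ->
    (\sum_(j <oo) (cmod (fourier mu (t j)) ^+ 2)%:E <= M%:E)%E.
  by apply: nneseries_le => j; exact: sqr_ge0.
have half0 : 0 < 2^-1 :> R by [].
have CP0 : 0 <= C ^+ 2 * pi ^+ 2 by rewrite mulr_ge0 ?sqr_ge0.
split=> [|A32].
  apply: gmin_sqr_le => [|g' g g'g fin]; first by rewrite divr_ge0// ltW.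
  have [n0 sep] := eventually_separated _ _ _ _ hlam g'g fin.
  have /andP[g'0 _] := g'g.
  (* The shift by 1 makes separation available from [n - 1] as well, where the left side starts. *)
  pose n := n0 + 1; pose xi := (lam n + lam (n - 1)) / 2.
  have gapn : g' <= lam n - lam (n - 1).
    by have [_] := sep n ltac:(lia) 1%N; rewrite mulr1.
  have hu j : g' * (j%:R + 2^-1) <= `|lam (n + j%:Z) - xi|.
    have [h _] := sep n ltac:(lia) j.
    by apply: le_trans (ler_norm _); rewrite /xi; lra.
  have hv j : g' * (j%:R + 2^-1) <= `|lam (n - 1 - j%:Z) - xi|.
    have [_ h] := sep (n - 1) ltac:(lia) j.
    by rewrite distrC; apply: le_trans (ler_norm _); rewrite /xi; lra.
  have U := series_le _ _ (fun J => sum_fourier_sqr_le _ _ _ hC hmu _ _ _ _ _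
    g'0 half0 hu (sum_invsqr_half R J)).
  have V := series_le _ _ (fun J => sum_fourier_sqr_le _ _ _ hC hmu _ _ _ _ _
    g'0 half0 hv (sum_invsqr_half R J)).
  have := le_trans (frame_fourier_char _ _ _ _ lam_inj hframe xi n) (leeD U V).
  rewrite -EFinD lee_fin => hAg.
  rewrite ler_pdivlMr// mulrC -ler_pdivlMr ?exprn_gt0//.
  lra.
apply: gmin_sqr_le => [|g' g g'g fin]; first by rewrite divr_ge0//; lra.
have [n sepn] := eventually_separated _ _ _ _ hlam g'g fin.
have {sepn} sep := sepn n (lexx n).
have /andP[g'0 _] := g'g.
(* The right side starts at [n + 1]: the point [lam n] is the centre itself and is counted apart. *)
have hu j : g' * (j%:R + 1) <= `|lam (n + j.+1%:Z) - lam n|.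
  have [h _] := sep j.+1.
  by apply: le_trans (ler_norm _); rewrite natr1.
have hv j : g' * (j%:R + 1) <= `|lam (n - 1 - j%:Z) - lam n|.
  have [_ h] := sep j.+1.
  have -> : n - 1 - j%:Z = n - j.+1%:Z by lia.
  by rewrite distrC; apply: le_trans (ler_norm _); rewrite natr1.
have U J : \sum_(j < J) cmod (fourier mu (lam (n + j%:Z) - lam n)) ^+ 2
    <= 1 + C ^+ 2 / g' ^+ 2 * (pi ^+ 2 / 6).
  have W J' := sum_fourier_sqr_le _ _ _ hC hmu _ _ _ _ _
    g'0 ltr01 hu (sum_invsqr R J').
  (* For the empty sum, [W 0] shows that the bound is nonnegative; otherwise the term [j = 0] is the
     transform at 0 and contributes the 1. *)
  case: J => [|J].
    rewrite big_ord0 addr_ge0//; apply: le_trans (W 0%N).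
    by rewrite big_ord0.
  by rewrite big_ord_recl addr0 subrr cmod_fourier0 expr1n lerD2l.
have V := series_le _ _ (fun J => sum_fourier_sqr_le _ _ _ hC hmu _ _ _ _ _
  g'0 ltr01 hv (sum_invsqr R J)).
have := le_trans (frame_fourier_char _ _ _ _ lam_inj hframe (lam n) n)
  (leeD (series_le _ _ U) V).
rewrite -EFinD lee_fin => hAg.
have A1 : 0 < A - 1 by lra.
rewrite ler_pdivlMr ?mulr_gt0// mulrC -ler_pdivlMr ?exprn_gt0//.
lra.
Qed.
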